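(* Let $\mathcal{H}$ be a real Hilbert space and $T:\mathcal{H}\to\mathcal{H}$ a nonexpansive operator with $\mathrm{Fix}\,T\ne\emptyset$. Let $(\alpha_k)_{k\ge0}\subseteq(0,1)$ satisfy $\lim_{k\to+\infty}\alpha_k=0$ and $\sum_{k\ge0}\alpha_k=+\infty$. Let $v,x_0\in\mathcal{H}$ and let $(x_k)_{k\ge0}$ be generated by $$x_{k+1}:=\alpha_kv+(1-\alpha_k)T(x_k)\quad\forall k\ge0 .$$ Assume that, in addition, $(\alpha_k)_{k\ge0}$ satisfies either $$\sum_{k\ge0}|\alpha_{k+1}-\alpha_k|<+\infty\qquad\text{or}\qquad\lim_{k\to+\infty}\frac{|\alpha_{k+1}-\alpha_k|}{\alpha_{k+1}}=0 .$$ Then $\|x_k-T(x_k)\|\to0$ as $k\to+\infty$, and therefore $(x_k)_{k\ge0}$ converges strongly to $\xi_*:=P_{\mathrm{Fix}\,T}(v)$ as $k\to+\infty$.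
   Context: $T$ is nonexpansive if $\|T(x)-T(y)\|\le\|x-y\|$ for all $x,y\in\mathcal{H}$. $\mathrm{Fix}\,T:=\{x\in\mathcal{H}:x=T(x)\}$, which is closed and convex; $P_{\mathrm{Fix}\,T}$ denotes the metric projection onto it. *)

(* Defs.v *)
From HB Require Import structures.
From mathcomp Require Import all_boot all_order all_algebra.
From mathcomp Require Import all_classical all_reals all_analysis.
From mathcomp Require Import ring lra.

Set Implicit Arguments.
Unset Strict Implicit.
Unset Printing Implicit Defensive.

Import Order.TTheory GRing.Theory Num.Theory.
Import numFieldNormedType.Exports.
Local Open Scope classical_set_scope.
Local Open Scope ring_scope.

(* A real Hilbert space is a complete normed module [H] over [R : realType]
   together with an inner product [dot : {dot H for idfun}] (a bilinear,
   symmetric, positive definite form) such that [dot u u = `|u| ^+ 2]. *)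

Definition nonexpansive (R : realType) (H : normedModType R) (T : H -> H) :=
  forall x y : H, `|T x - T y| <= `|x - y|.

Definition fixpoints (R : realType) (H : normedModType R) (T : H -> H) : set H :=
  [set x | x = T x].

Definition nearest_points (R : realType) (H : normedModType R) (C : set H)
    (v : H) : set H :=
  [set p | C p /\ forall y, C y -> `|v - p| <= `|v - y|].

(* The default value 0 is never used when [C] is a nonempty closed convex
   subset of a Hilbert space: see [metric_projP] and [metric_proj_unique]. *)
Definition metric_proj (R : realType) (H : normedModType R) (C : set H)
    (v : H) : H :=
  xget 0 (nearest_points C v).

(* The parallelogram identity at the midpoint of two almost nearest points. *)
Lemma nearest_points_near (R : realType) (H : normedModType R)
    (dot : {dot H for idfun}) (dotE : forall u : H, dot u u = `|u| ^+ 2)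
    (C : set H) (Cconvex : convex_set (C : set (convex_lmodType H))) (v : H)
    (d e1 e2 : R) (p q : H) :
  (forall y, C y -> d <= `|v - y| ^+ 2) -> C p -> C q ->
  `|v - p| ^+ 2 <= d + e1 -> `|v - q| ^+ 2 <= d + e2 ->
  `|p - q| ^+ 2 <= (e1 + e2) *+ 2.
Proof.
move=> dle Cp Cq vp vq.
have Cm : C (2^-1 *: p + 2^-1 *: q).
  have h0 : 0 <= 2^-1 :> R by lra.
  have h1 : 2^-1 <= 1 :> R by lra.
  have := Cconvex p q (Itv01 h0 h1) (mem_set Cp) (mem_set Cq).
  by rewrite in_setE; congr (C (_ + _ *: q)) => /=; rewrite /unstable.onem; lra.
have dm := dle _ Cm.
pose a := v - p; pose b := v - q.
have pq : p - q = b - a by rewrite /a /b opprB [RHS]addrC subrKA.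
have mE : v - (2^-1 *: p + 2^-1 *: q) = 2^-1 *: (a + b).
  rewrite scalerDr !scalerBr addrACA -opprD -scalerDl.
  by rewrite (_ : 2^-1 + 2^-1 = 1 :> R) ?scale1r//; lra.
move: dm vp vq; rewrite -/a -/b pq mE -!dotE {pq mE}.
move: a b => a b.
rewrite (hnormB (theta := idfun)) /= linearZl_LR /= linearZr_LR /=.
rewrite (hnormD (theta := idfun)) /= expr0 !mul1r => dm va vb.
have := hermC dot a b; rewrite /= expr0 mul1r => dab.
lra.
Qed.

Lemma nearest_points_unique (R : realType) (H : normedModType R)
    (dot : {dot H for idfun}) (dotE : forall u : H, dot u u = `|u| ^+ 2)
    (C : set H) (Cconvex : convex_set (C : set (convex_lmodType H))) (v : H) :
  is_subset1 (nearest_points C v).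
Proof.
move=> p q [Cp vp] [Cq vq].
have dle y : C y -> `|v - p| ^+ 2 <= `|v - y| ^+ 2.
  by move=> Cy; rewrite lerXn2r ?nnegrE// vp.
have := @nearest_points_near _ _ _ dotE _ Cconvex v _ 0 0 p q dle Cp Cq.
rewrite !addr0 mul0rn => /(_ (lexx _)).
rewrite lerXn2r ?nnegrE ?vq// => /(_ isT) pq0; apply/eqP.
by rewrite -subr_eq0 -normr_eq0 -sqrf_eq0 eq_le pq0 sqr_ge0.
Qed.

Lemma nearest_points_nonempty (R : realType) (H : completeNormedModType R)
    (dot : {dot H for idfun}) (dotE : forall u : H, dot u u = `|u| ^+ 2)
    (C : set H) (Cconvex : convex_set (C : set (convex_lmodType H)))
    (Cclosed : closed C) (C0 : C !=set0) (v : H) :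
  nearest_points C v !=set0.
Proof.
pose D := [set `|v - y| ^+ 2 | y in C].
have D0 : D !=set0 by case: C0 => y Cy; exists (`|v - y| ^+ 2), y.
have Dinf : has_inf D.
  by split=> //; exists 0 => _ [y _ <-]; exact: sqr_ge0.
have dle y : C y -> inf D <= `|v - y| ^+ 2.
  by move=> Cy; apply: ge_inf; [exact: Dinf.2 | exists y].
have /choice[p pP] (n : nat) :
    exists p, C p /\ `|v - p| ^+ 2 <= inf D + n.+1%:R^-1.
  have [|_ [y Cy <-] /ltW ylt] := @inf_adherent _ D n.+1%:R^-1 _ Dinf.
    by rewrite invr_gt0.
  by exists y.
have pcvg : cvgn p.
  apply/cauchy_cvgP/cauchy_exP => e e0.
  have e2 : 0 < e ^+ 2 / 4 by rewrite divr_gt0// exprn_gt0.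
  have [N _ NP] := near_infty_natSinv_lt (PosNum e2).
  exists (p N); rewrite /nbhs/=; exists N => // n /= Nn.
  rewrite -ball_normE /ball_/= -(@ltr_pXn2r _ 2)// ?nnegrE// ?ltW//.
  apply: le_lt_trans (nearest_points_near dotE Cconvex dle
    (pP N).1 (pP n).1 (pP N).2 (pP n).2) _.
  have /= := NP n Nn; have /= := NP N (leqnn N).
  move: N.+1%:R^-1 n.+1%:R^-1 => s t; lra.
exists (limn p); split.
  by apply: (closed_cvg _ Cclosed _ _ pcvg); apply: nearW => n; exact: (pP n).1.
move=> y Cy; rewrite -(@ler_pXn2r _ 2) ?nnegrE//; apply: le_trans (dle _ Cy).
have vpcvg : `|v - p n| ^+ 2 @[n --> \oo] --> `|v - limn p| ^+ 2.
  by apply: cvgM; apply: cvg_norm; apply: cvgB => //; exact: cvg_cst.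
have dcvg : inf D + n.+1%:R^-1 @[n --> \oo] --> inf D + 0.
  by apply: cvgD; [exact: cvg_cst | exact: cvg_harmonic].
rewrite -[leRHS]addr0; apply: ler_cvg_to vpcvg dcvg _.
by apply: nearW => n; exact: (pP n).2.
Qed.

Lemma metric_projP (R : realType) (H : completeNormedModType R)
    (dot : {dot H for idfun}) (dotE : forall u : H, dot u u = `|u| ^+ 2)
    (C : set H) (Cconvex : convex_set (C : set (convex_lmodType H)))
    (Cclosed : closed C) (C0 : C !=set0) (v : H) :
  nearest_points C v (metric_proj C v).
Proof.
by apply: xgetPex; apply: nearest_points_nonempty dotE _ Cconvex Cclosed C0 v.
Qed.

Lemma metric_proj_unique (R : realType) (H : normedModType R)
    (dot : {dot H for idfun}) (dotE : forall u : H, dot u u = `|u| ^+ 2)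
    (C : set H) (Cconvex : convex_set (C : set (convex_lmodType H))) (v p : H) :
  nearest_points C v p -> metric_proj C v = p.
Proof.
move=> pP; apply: xget_subset1 pP _.
exact: nearest_points_unique dotE _ Cconvex v.
Qed.

(* Main.v *)
Require Import Defs.
From HB Require Import structures.
From mathcomp Require Import all_boot all_order all_algebra.
From mathcomp Require Import all_classical all_reals all_analysis.
From mathcomp Require Import lra.

Set Implicit Arguments.
Unset Strict Implicit.
Unset Printing Implicit Defensive.

Import Order.TTheory GRing.Theory Num.Theory.
Import numFieldNormedType.Exports.
Local Open Scope classical_set_scope.
Local Open Scope ring_scope.

(** Write [P] for the projection of [v] onto the fixed points. The proof needs
no weak compactness; it compares the iterates with the curve of points [z]
solving [z - T z = l (v - z)] for [l > 0], which exist by the Banach fixed point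
theorem. Since [I - T] is monotone, two such points [z] and [y], with parameters
[l > m >= 0], satisfy (lemma [resolvent_dist])
<<
   |z - y|^2 <= |v - y|^2 - |v - z|^2.
>>
A fixed point is the case [m = 0]. Hence, along [l = 1/(n+1)], the distance
[|v - z|] increases and is bounded, so that the points [z] form a Cauchy
sequence; the same inequality identifies the limit with [P]
([resolvent_cvg]).

Monotonicity also bounds [<v - P, y - P>], for every [y], by a constant times
[|z - P| + |y - T y| / l] ([resolvent_dot_le]). Fixing [l] small first, it
follows that asymptotic regularity of [x] gives
[limsup <v - P, x_k - P> <= 0] ([dot_limsup_le0]).

Everything is then reduced to real sequences with
<<
   s_(k+1) <= (1 - a_k) s_k + a_k b_k + c_k,
>>
where [a] has divergent sum, [limsup b <= 0] and [c] is summable: they tend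
to [0] ([recursion_cvg0]). For [s_k = |x_(k+1) - x_k|] this yields asymptotic
regularity, the variation of the step sizes going into [c] or into [b] according
to which of the two conditions holds; for [s_k = |x_k - P|^2] it yields strong
convergence. *)

(** * Divergent series and a recursive inequality *)

Lemma nneseries_pinfty_cvg (R : realType) (a : R^nat) :
  (forall k, 0 <= a k) -> (\sum_(0 <= k <oo) (a k)%:E = +oo)%E ->
  series a n @[n --> \oo] --> +oo.
Proof.
move=> a0 aoo; apply/cvgeryP.
have /cvg_ex[l al] : cvgn (fun n => \sum_(0 <= k < n) (a k)%:E)%E.
  by apply: is_cvg_nneseries => k _ _; rewrite lee_fin.
have ll : l = +oo%E by rewrite -aoo -(cvg_lim _ al).
rewrite ll in al; rewrite /series; under eq_fun do rewrite -sumEFin.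
exact: al.
Qed.

Lemma cvg_series_shift_pinfty (R : realType) (a : R^nat) :
  series a n @[n --> \oo] --> +oo ->
  series (fun k => a k.+1) n @[n --> \oo] --> +oo.
Proof.
move=> /cvgryPge aoo; apply/cvgryPge => M.
have [N _ NP] := aoo (M + a 0%N); exists N => // n Nn /=.
have := NP n.+1 (leqW Nn); rewrite /series /= big_nat_recl//; lra.
Qed.

(** From a rank [N] on, [u_n = s_n - e/3 - (c_N + ... + c_(n-1))] satisfies
[u_(n+1) <= (1 - a_n) u_n], and the product of the factors [1 - a_n] is at most
[1 / (1 + a_N + ... + a_(n-1))], which tends to [0]. *)
Lemma recursion_cvg0 (R : realType) (a b c s : R^nat) :
  (forall k, 0 <= a k <= 1) -> series a n @[n --> \oo] --> +oo ->
  (forall e, 0 < e -> \forall k \near \oo, b k <= e) ->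
  (forall k, 0 <= c k) -> cvgn (series c) -> (forall k, 0 <= s k) ->
  (forall k, s k.+1 <= (1 - a k) * s k + a k * b k + c k) ->
  s k @[k --> \oo] --> 0.
Proof.
move=> a01 aoo b0 c0 ccvg s0 srec; apply/cvgrPdist_le => e e0.
have e3 : 0 < e / 3 by lra.
have cnd : nondecreasing_seq (series c).
  by apply/nondecreasing_seqP => n; rewrite seriesSr /= lerDl.
have [N _ NP] : \forall N \near \oo,
    b N <= e / 3 /\ `|limn (series c) - series c N| <= e / 3.
  by near=> N; split; near: N; [exact: b0 | move/cvgrPdist_le: ccvg; exact].
(* [S] and [C] are the partial sums of [a] and [c] from rank [N] on. *)
pose S n := series a (N + n)%N - series a N.
pose C n := series c (N + n)%N - series c N.
have SS n : S n.+1 = S n + a (N + n)%N.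
  by rewrite /S addnS seriesSr/=; lra.
have CS n : C n.+1 = C n + c (N + n)%N.
  by rewrite /C addnS seriesSr/=; lra.
have S0 n : 0 <= S n.
  elim: n => [|n IH]; first by rewrite /S addn0 subrr.
  by rewrite SS addr_ge0//; case/andP: (a01 (N + n)%N).
have Cge0 n : 0 <= C n by rewrite subr_ge0 cnd// leq_addr.
have Cle n : C n <= e / 3.
  have := nondecreasing_cvgn_le cnd ccvg (N + n)%N.
  have [_] := NP N (leqnn N); rewrite ler_norml /C; lra.
(* The inductive step uses [(1 - a) (1 + S + a) <= 1 + S]. *)
have bound n : s (N + n)%N - e / 3 - C n <= s N / (1 + S n).
  elim: n => [|n IH].
    by rewrite /C /S addn0 !subrr addr0 divr1; lra.
  have [bN _] := NP (N + n)%N (leq_addr _ _).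
  have := srec (N + n)%N; have /andP[a0 a1] := a01 (N + n)%N.
  rewrite addnS CS SS => sle.
  apply: (@le_trans _ _ ((1 - a (N + n)%N) * (s N / (1 + S n)))).
    apply: le_trans (ler_wpM2l _ IH); last by lra.
    have := ler_wpM2l a0 bN; have := mulr_ge0 a0 (Cge0 n); lra.
  rewrite mulrCA ler_wpM2l// ler_pdivrMr ?ltr_wpDr//.
  rewrite -ler_pdivrMl ?invr_gt0; last by have := S0 n; lra.
  rewrite invrK.
  have := mulr_ge0 (S0 n) a0; have := sqr_ge0 (a (N + n)%N).
  nra.
move/cvgryPge: aoo => /(_ (3 * s N / e + series a N)) [N' _ N'P].
exists (N + N')%N => // n /= Nn; rewrite sub0r normrN ger0_norm//.
have Nlen : (N <= n)%N by apply: leq_trans Nn; rewrite leq_addr.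
have := bound (n - N)%N; have := Cle (n - N)%N.
have /= := N'P n (leq_trans (leq_addl _ _) Nn).
have := S0 (n - N)%N; rewrite /S subnKC// => S0n Sn Cn.
suff : s N / (1 + (series a n - series a N)) <= e / 3 by lra.
rewrite ler_pdivrMr; last by lra.
move: Sn; rewrite -lerBrDr ler_pdivrMr//; lra.
Unshelve. all: end_near. Qed.

(** * Inner product estimates *)

Section RealInnerProduct.
Context {R : realType} {H : normedModType R} (dot : {dot H for idfun}).
Context (dotE : forall u : H, dot u u = `|u| ^+ 2).
Implicit Types u w : H.

Lemma dotC u w : dot u w = dot w u.
Proof. by rewrite hermC /= expr0 mul1r. Qed.

Lemma sqr_normD u w : `|u + w| ^+ 2 = `|u| ^+ 2 + dot u w *+ 2 + `|w| ^+ 2.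
Proof. by rewrite -!dotE hnormD /= expr0 mul1r; lra. Qed.

Lemma sqr_normB u w : `|u - w| ^+ 2 = `|u| ^+ 2 - dot u w *+ 2 + `|w| ^+ 2.
Proof. by rewrite sqr_normD linearNr normrN mulNrn. Qed.

Lemma dot_le_norm u w : dot u w <= `|u| * `|w|.
Proof.
have : `|u + w| ^+ 2 <= (`|u| + `|w|) ^+ 2.
  by rewrite lerXn2r ?nnegrE ?addr_ge0// ler_normD.
by rewrite sqr_normD; lra.
Qed.

End RealInnerProduct.

(** * Resolvent points of a nonexpansive operator *)

Section Resolvent.
Context {R : realType} {H : completeNormedModType R} (dot : {dot H for idfun}).
Context (dotE : forall u : H, dot u u = `|u| ^+ 2).
Context (T : H -> H) (T_nonexp : nonexpansive T) (v : H).

(** The displacement operator [x |-> x - T x] is monotone. *)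
Lemma nonexpansive_monotone x y : 0 <= dot ((x - T x) - (y - T y)) (x - y).
Proof.
have -> : (x - T x) - (y - T y) = (x - y) - (T x - T y).
  by rewrite !opprB addrACA [RHS]addrACA; congr (_ + _); rewrite addrC.
rewrite linearBl /= dotE subr_ge0.
apply: le_trans (dot_le_norm dotE _ _) _.
by rewrite expr2 ler_wpM2r.
Qed.

(** [z] is the fixed point of the contraction [z |-> (l v + T z) / (1 + l)]. *)
Lemma resolvent_ex (l : R) : 0 < l -> exists z, z - T z = l *: (v - z).
Proof.
move=> l0; have l1 : 0 < 1 + l by lra.
pose g z := (1 + l)^-1 *: (l *: v + T z).
have gfun : set_fun [set: H] [set: H] g by [].
pose g' : {fun [set: H] >-> [set: H]} := HB.pack g (isFun.Build _ _ _ _ g gfun).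
have gctr : is_contraction g'.
  have q0 : 0 <= (1 + l)^-1 by rewrite invr_ge0 ltW.
  exists (NngNum q0); split => /=; first by rewrite invf_lt1//; lra.
  move=> [y z] _ /=; rewrite /g -scalerBr normrZ ger0_norm// ler_wpM2l//.
  by rewrite opprD addrACA subrr add0r T_nonexp.
have [|z _ zE] := banach_fixed_point gctr closedT; first by exists 0.
exists z; apply/eqP; rewrite subr_eq scalerBr.
have -> : l *: v - l *: z + T z = (1 + l) *: z - l *: z.
  by rewrite [in (1 + l) *: z]zE /= /g scalerA divff ?gt_eqF// scale1r addrAC.
by rewrite -scalerBl addrK scale1r.
Qed.

(** Monotonicity between [z] and [y], with [a = v - z] and [b = v - y], reads
[0 <= <l a - m b, b - a>], that is
[(l + m) |b - a|^2 <= (l - m) (|b|^2 - |a|^2)]. *)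
Lemma resolvent_dist (l m : R) z y : 0 <= m -> m < l ->
  z - T z = l *: (v - z) -> y - T y = m *: (v - y) ->
  `|z - y| ^+ 2 <= `|v - y| ^+ 2 - `|v - z| ^+ 2.
Proof.
move=> m0 ml zE yE; have := nonexpansive_monotone z y; rewrite zE yE.
have -> : z - y = (v - y) - (v - z) by rewrite opprB [RHS]addrC subrKA.
move: (v - z) (v - y) => a b.
rewrite linearBl !linearBr /= !linearZl_LR /= !dotE (sqr_normB dotE).
have := sqr_ge0 `|b - a|; rewrite (sqr_normB dotE) (dotC dot a b).
move: (dot b a) (`|a| ^+ 2) (`|b| ^+ 2) => d A B D0 mon.
have lm : (l + m) * (B - d *+ 2 + A) <= (l - m) * (B - A) by lra.
have AB : 0 <= B - A.
  rewrite -(@pmulr_rge0 _ (l - m)) ?subr_gt0//; apply: le_trans lm.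
  by rewrite mulr_ge0//; lra.
rewrite -(@ler_pM2l _ (l + m)); last by lra.
by apply: le_trans lm _; rewrite ler_wpM2r//; lra.
Qed.

End Resolvent.

Section ResolventLimit.
Context {R : realType} {H : completeNormedModType R} (dot : {dot H for idfun}).
Context (dotE : forall u : H, dot u u = `|u| ^+ 2).
Context (T : H -> H) (T_nonexp : nonexpansive T) (v : H).

Lemma resolvent_dist_fix l z p : 0 < l -> z - T z = l *: (v - z) ->
  fixpoints T p -> `|z - p| ^+ 2 <= `|v - p| ^+ 2 - `|v - z| ^+ 2.
Proof.
move=> l0 zE Tp; apply: (resolvent_dist dotE T_nonexp (lexx 0) l0 zE).
by rewrite scale0r -Tp subrr.
Qed.

(** Membership of the projection in the set of fixed points is obtained at the
same time: the limit is itself a nearest fixed point to [v]. *)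
Lemma resolvent_cvg (z : nat -> H) : fixpoints T !=set0 ->
  (forall n, z n - T (z n) = n.+1%:R^-1 *: (v - z n)) ->
  fixpoints T (metric_proj (fixpoints T) v) /\
  z n @[n --> \oo] --> metric_proj (fixpoints T) v.
Proof.
move=> [p0 Tp0] zE.
have l0 n : 0 < n.+1%:R^-1 :> R by rewrite invr_gt0.
pose A n : R := `|v - z n| ^+ 2.
have zmn m n : (m <= n)%N -> `|z m - z n| ^+ 2 <= A n - A m.
  rewrite leq_eqVlt => /predU1P[->|mn].
    by rewrite !subrr normr0 expr0n.
  apply: (resolvent_dist dotE T_nonexp (ltW (l0 n)) _ (zE m) (zE n)).
  by rewrite ltf_pV2 ?posrE// ltr_nat.
have zp n p : fixpoints T p -> `|z n - p| ^+ 2 <= `|v - p| ^+ 2 - A n.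
  exact: resolvent_dist_fix (l0 n) (zE n).
have And : nondecreasing_seq A.
  by move=> m n mn; rewrite -subr_ge0; apply: le_trans (zmn _ _ mn).
have Acvg : cvgn A.
  apply: nondecreasing_is_cvgn => //; exists (`|v - p0| ^+ 2) => _ [n _ <-].
  by rewrite -subr_ge0; apply: le_trans (zp n p0 Tp0).
have zcvg : cvgn z.
  apply/cauchy_cvgP/cauchy_exP => e e0.
  have e2 : 0 < e ^+ 2 by rewrite exprn_gt0.
  have /cvgrPdist_lt/(_ _ e2)[N _ NP] := Acvg.
  exists (z N); exists N => // n /= Nn; rewrite -ball_normE /=.
  rewrite -(@ltr_pXn2r _ 2)// ?nnegrE ?(ltW e0)//.
  apply: le_lt_trans (zmn _ _ Nn) _.
  have := NP N (leqnn N); have := nondecreasing_cvgn_le And Acvg n.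
  rewrite /= ltr_norml; lra.
set q := limn z in zcvg.
have vzcvg : A n @[n --> \oo] --> `|v - q| ^+ 2.
  by apply: cvgM; apply: cvg_norm; apply: cvgB => //; exact: cvg_cst.
(* [|q - T q| <= |q - z n| + |z n - T (z n)| + |T (z n) - T q|]. *)
have Tq : fixpoints T q.
  rewrite /fixpoints /=; apply/eqP; rewrite -subr_eq0 -normr_le0.
  pose f n := `|q - z n| + n.+1%:R^-1 * `|v - z n| + `|z n - q|.
  have fcvg : f n @[n --> \oo] --> `|q - q| + 0 * `|v - q| + `|q - q|.
    apply: cvgD; [apply: cvgD; [|apply: cvgM] |].
    - by apply: cvg_norm; apply: cvgB => //; exact: cvg_cst.
    - exact: cvg_harmonic.
    - by apply: cvg_norm; apply: cvgB => //; exact: cvg_cst.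
    - by apply: cvg_norm; apply: cvgB => //; exact: cvg_cst.
  have -> : 0 = `|q - q| + 0 * `|v - q| + `|q - q|.
    by rewrite subrr normr0 mul0r !addr0.
  apply: (ler_cvg_to (cvg_cst _) fcvg); apply: nearW => n.
  rewrite -(subrKA (z n) q) -(subrKA (T (z n)) (z n)) addrA.
  apply: le_trans (ler_normD _ _) _; rewrite lerD//.
  by apply: le_trans (ler_normD _ _) _; rewrite lerD// zE normrZ ger0_norm.
have qP p : fixpoints T p -> `|q - p| ^+ 2 <= `|v - p| ^+ 2 - `|v - q| ^+ 2.
  move=> Tp.
  have zpcvg : `|z n - p| ^+ 2 @[n --> \oo] --> `|q - p| ^+ 2.
    by apply: cvgM; apply: cvg_norm; apply: cvgB => //; exact: cvg_cst.
  have vpcvg : `|v - p| ^+ 2 - A n @[n --> \oo] -->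
      `|v - p| ^+ 2 - `|v - q| ^+ 2.
    by apply: cvgB => //; exact: cvg_cst.
  by apply: ler_cvg_to zpcvg vpcvg _; apply: nearW => n; exact: zp.
have : nearest_points (fixpoints T) v (metric_proj (fixpoints T) v).
  apply: xgetPex; exists q; split=> // y /qP qy.
  by rewrite -(@ler_pXn2r _ 2) ?nnegrE// -subr_ge0; apply: le_trans qy.
set P := metric_proj _ _ => -[TP /(_ q Tq) vPq].
suff -> : P = q by split.
apply/eqP; rewrite eq_sym -subr_eq0 -normr_eq0 -sqrf_eq0 eq_le sqr_ge0 andbT.
by apply: le_trans (qP _ TP) _; rewrite subr_le0 lerXn2r ?nnegrE.
Qed.

Lemma fixpoints_metric_proj : fixpoints T !=set0 ->
  fixpoints T (metric_proj (fixpoints T) v).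
Proof.
move=> Tne.
have l0 n : 0 < n.+1%:R^-1 :> R by rewrite invr_gt0.
have [z zE] := choice (fun n => resolvent_ex T_nonexp v (l0 n)).
by have [] := resolvent_cvg Tne zE.
Qed.

End ResolventLimit.

(** * The Halpern iteration *)

Section Halpern.
Context {R : realType} {H : completeNormedModType R} (dot : {dot H for idfun}).
Context (dotE : forall u : H, dot u u = `|u| ^+ 2).
Context (T : H -> H) (T_nonexp : nonexpansive T) (v : H).

(** For [y] an approximate fixed point and [z] close to [p], [<v - p, y - p>] is
almost nonpositive: it differs from [<v - z, y - z>] by terms of order
[|z - p|], and monotonicity gives [l <v - z, y - z> <= <y - T y, y - z>]. *)
Lemma resolvent_dot_le (l : R) z p y : 0 < l -> z - T z = l *: (v - z) ->
  fixpoints T p ->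
  dot (v - p) (y - p) <=
    (`|v - p| + `|y - p|) * (`|z - p| + `|y - T y| / l).
Proof.
move=> l0 zE Tp.
have zp := resolvent_dist_fix dotE T_nonexp l0 zE Tp.
have zple : `|z - p| <= `|v - p|.
  rewrite -(@ler_pXn2r _ 2) ?nnegrE//; apply: le_trans zp _.
  by rewrite gerBl sqr_ge0.
have vzle : `|v - z| <= `|v - p|.
  rewrite -(@ler_pXn2r _ 2) ?nnegrE// -subr_ge0; apply: le_trans zp.
  exact: sqr_ge0.
have -> : dot (v - p) (y - p) =
    dot (z - p) (y - p) + dot (v - z) (z - p) + dot (v - z) (y - z).
  have -> : v - p = (v - z) + (z - p) by rewrite subrKA.
  have -> : y - p = (y - z) + (z - p) by rewrite subrKA.
  by rewrite !linearDl /= !linearDr /=; lra.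
have yzle : `|y - z| <= `|v - p| + `|y - p|.
  rewrite -(subrKA p y); apply: le_trans (ler_normD _ _) _.
  by rewrite (distrC p z) addrC lerD.
have h1 := dot_le_norm dotE (z - p) (y - p).
have h2 := dot_le_norm dotE (v - z) (z - p).
have h3 : dot (v - z) (y - z) <= `|y - T y| / l * `|y - z|.
  have := nonexpansive_monotone dotE T_nonexp y z.
  rewrite zE linearBl linearZl_LR /= => mon.
  rewrite mulrAC ler_pdivlMr//.
  by have := dot_le_norm dotE (y - T y) (y - z); lra.
have h4 : `|y - T y| / l * `|y - z| <= `|y - T y| / l * (`|v - p| + `|y - p|).
  by rewrite ler_wpM2l// divr_ge0// ltW.
have h5 : `|v - z| * `|z - p| <= `|v - p| * `|z - p| by rewrite ler_wpM2r.
lra.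
Qed.

(** The parameter [1/(n+1)] is fixed first, so that [|z n - P|] is small; then
[|x k - T (x k)|] becomes small compared with it. *)
Lemma dot_limsup_le0 (x : nat -> H) (M : R) :
  let P := metric_proj (fixpoints T) v in
  fixpoints T P -> (forall k, `|x k - P| <= M) ->
  `|x k - T (x k)| @[k --> \oo] --> 0 ->
  forall e, 0 < e -> \forall k \near \oo, dot (v - P) (x k - P) <= e.
Proof.
move=> P TP xM xT e e0.
have l0 n : 0 < n.+1%:R^-1 :> R by rewrite invr_gt0.
have [z zE] := choice (fun n => resolvent_ex T_nonexp v (l0 n)).
(* The summand [1] makes [K] positive, for the divisions below. *)
pose K := `|v - P| + M + 1.
have M0 : 0 <= M by exact: le_trans (normr_ge0 _) (xM 0%N).
have K0 : 0 < K by rewrite ltr_wpDl// addr_ge0.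
have eK : 0 < e / K / 2 by rewrite !divr_gt0.
have ne : fixpoints T !=set0 by exists P.
have [_ zcvg] := resolvent_cvg dotE T_nonexp ne zE.
have /cvgrPdist_le/(_ _ eK)[n _ nP] := zcvg.
have enK : 0 < e / K / 2 * n.+1%:R^-1 by rewrite mulr_gt0.
move/cvgrPdist_le: xT => /(_ _ enK); apply: filterS => k.
rewrite sub0r normrN normr_id -ler_pdivrMr// => xTk.
apply: le_trans (resolvent_dot_le _ (l0 n) (zE n) TP) _.
have zn := nP n (leqnn n); rewrite /= distrC -/P in zn.
apply: (@le_trans _ _ (K * (e / K))); last first.
  by rewrite mulrCA divff ?mulr1// gt_eqF.
rewrite ler_pM ?addr_ge0 ?divr_ge0//; last by lra.
by have := xM k; rewrite /K; lra.
Qed.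

Context (a : R^nat) (x : nat -> H).
Context (a01 : forall k, 0 < a k < 1).
Context (x_rec : forall k, x k.+1 = a k *: v + (1 - a k) *: T (x k)).

Lemma halpern_bounded p k : fixpoints T p ->
  `|x k - p| <= `|x 0%N - p| + `|v - p|.
Proof.
move=> Tp; elim: k => [|k IH]; first by rewrite lerDl.
have /andP[a0 a1] := a01 k.
have -> : x k.+1 - p = a k *: (v - p) + (1 - a k) *: (T (x k) - T p).
  rewrite x_rec -Tp !scalerBr addrACA -opprD -scalerDl.
  by rewrite (_ : a k + (1 - a k) = 1) ?scale1r//; lra.
apply: le_trans (ler_normD _ _) _.
rewrite !normrZ (gtr0_norm a0) gtr0_norm ?subr_gt0//.
have h1 : (1 - a k) * `|T (x k) - T p| <=
    (1 - a k) * (`|x 0%N - p| + `|v - p|).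
  by rewrite ler_wpM2l ?subr_ge0 ?(ltW a1)//; apply: le_trans IH.
have h2 : 0 <= a k * `|x 0%N - p| by rewrite mulr_ge0// ltW.
lra.
Qed.

(** Obtained by expanding [|y - a_k u|^2 = (1 - a_k)^2 |T x_k - p|^2] with
[y = x_(k+1) - p] and [u = v - p]. *)
Lemma halpern_step p k : fixpoints T p ->
  `|x k.+1 - p| ^+ 2 <=
    (1 - a k) * `|x k - p| ^+ 2 + a k * (dot (v - p) (x k.+1 - p) *+ 2).
Proof.
move=> Tp; have /andP[a0 a1] := a01 k.
have yE : x k.+1 - p - a k *: (v - p) = (1 - a k) *: (T (x k) - T p).
  rewrite x_rec -Tp !scalerBr (scalerBl 1 (a k) p) scale1r !opprB.
  by rewrite addrA addrC !addrA addNr add0r addrAC.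
have := sqr_normB dotE (x k.+1 - p) (a k *: (v - p)).
rewrite yE linearZr_LR /= (dotC dot (x _ - p)) normrZ exprMn.
have w2 : `|T (x k) - T p| ^+ 2 <= `|x k - p| ^+ 2.
  by rewrite lerXn2r ?nnegrE.
have bw : `|1 - a k| ^+ 2 * `|T (x k) - T p| ^+ 2 <=
    (1 - a k) * `|x k - p| ^+ 2.
  rewrite ger0_norm ?subr_ge0 ?(ltW a1)// expr2 -mulrA ler_wpM2l//; first lra.
  apply: le_trans w2; rewrite ler_piMl ?sqr_ge0//; lra.
by have := sqr_ge0 `|a k *: (v - p)|; lra.
Qed.

Lemma halpern_increment M k : (forall k, `|v - T (x k)| <= M) ->
  `|x k.+2 - x k.+1| <=
    (1 - a k.+1) * `|x k.+1 - x k| + M * `|a k.+1 - a k|.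
Proof.
move=> vM; have /andP[a0 a1] := a01 k.+1.
have -> : x k.+2 - x k.+1 = (1 - a k.+1) *: (T (x k.+1) - T (x k)) +
    (a k.+1 - a k) *: (v - T (x k)).
  rewrite !scalerBr addrACA -opprD -scalerDl subrKA.
  rewrite (scalerBl _ _ v) (x_rec k.+1) {2}(x_rec k) opprD !addrA.
  by rewrite [_ *: v + _]addrC.
apply: le_trans (ler_normD _ _) _.
rewrite !normrZ gtr0_norm ?subr_gt0// lerD//.
  by rewrite ler_wpM2l ?subr_ge0 ?(ltW a1).
by rewrite mulrC ler_wpM2r.
Qed.

(** The successive differences satisfy the recursive inequality with the shifted
coefficients [a_(k+1)], so they tend to [0]; and so does
[x_(k+1) - T x_k = a_k (v - T x_k)]. *)
Lemma halpern_asymptotic_regular (M : R) : (forall k, `|v - T (x k)| <= M) ->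
  a k @[k --> \oo] --> 0 -> series a n @[n --> \oo] --> +oo ->
  (\sum_(0 <= k <oo) `|a k.+1 - a k|%:E < +oo)%E \/
    `|a k.+1 - a k| / a k.+1 @[k --> \oo] --> 0 ->
  `|x k - T (x k)| @[k --> \oo] --> 0.
Proof.
move=> vM acvg adiv avar.
have M0 : 0 <= M := le_trans (normr_ge0 _) (vM 0%N).
have a01w k : 0 <= a k.+1 <= 1 by case/andP: (a01 k.+1) => /ltW -> /ltW.
have step k := halpern_increment k vM.
have dcvg : `|x k.+1 - x k| @[k --> \oo] --> 0.
  (* The variation is the summable term [c] in the first case, and the term [b],
     after division by [a_(k+1)], in the second. *)
  case: avar => [asum | aratio].
    apply: (recursion_cvg0 (b := fun=> 0)
        (c := fun k => M * `|a k.+1 - a k|) a01w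
        (cvg_series_shift_pinfty adiv)) => //.
    - by move=> e e0; apply: nearW => k; exact: ltW.
    - by move=> k; rewrite mulr_ge0.
    - apply: (@is_cvg_seriesZ _ _ M); exact: nnseries_is_cvg.
    - by move=> k; rewrite mulr0 addr0.
  apply: (recursion_cvg0 (b := fun k => M * (`|a k.+1 - a k| / a k.+1))
      (c := fun=> 0) a01w (cvg_series_shift_pinfty adiv)) => //.
  - move=> e e0.
    have : M * (`|a k.+1 - a k| / a k.+1) @[k --> \oo] --> M * 0.
      by apply: cvgM => //; exact: cvg_cst.
    rewrite mulr0 => /cvgrPdist_le/(_ _ e0); apply: filterS => k.
    by rewrite sub0r normrN; apply: le_trans; exact: ler_norm.
  - rewrite (_ : series _ = fun=> 0); first exact: is_cvg_cst.
    by apply/funext => n; rewrite /series /= big1.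
  - move=> k; rewrite addr0 mulrCA [a k.+1 * _]mulrC divfK//.
    by rewrite gt_eqF//; case/andP: (a01 k.+1).
have ub : `|x k.+1 - x k| + a k * M @[k --> \oo] --> 0.
  rewrite -[X in _ --> X](addr0 0) -{2}(mul0r M).
  by apply: cvgD => //; apply: cvgM => //; exact: cvg_cst.
apply: (squeeze_cvgr _ (cvg_cst 0) ub); apply: nearW => k.
rewrite normr_ge0 /= -(subrKA (x k.+1) (x k)).
apply: le_trans (ler_normD _ _) _; rewrite distrC lerD//.
have /andP[a0 _] := a01 k.
have -> : x k.+1 - T (x k) = a k *: (v - T (x k)).
  by rewrite x_rec scalerBl scale1r scalerBr [T _ - _]addrC addrA addrK.
by rewrite normrZ gtr0_norm// ler_wpM2l// ltW.
Qed.

End Halpern.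

Theorem theorem4p3 (R : realType) (H : completeNormedModType R)
    (dot : {dot H for idfun}) (dotE : forall u : H, dot u u = `|u| ^+ 2)
    (T : H -> H) (T_nonexp : nonexpansive T) (FixT_neq0 : fixpoints T !=set0)
    (alpha : nat -> R) (alpha01 : forall k, 0 < alpha k < 1)
    (alpha_cvg0 : alpha k @[k --> \oo] --> 0)
    (alpha_sum : (\sum_(0 <= k <oo) (alpha k)%:E = +oo)%E)
    (v x0 : H) (x : nat -> H) (x_init : x 0%N = x0)
    (x_rec : forall k, x k.+1 = alpha k *: v + (1 - alpha k) *: T (x k))
    (alpha_var :
      (\sum_(0 <= k <oo) `|alpha k.+1 - alpha k|%:E < +oo)%E \/
      `|alpha k.+1 - alpha k| / alpha k.+1 @[k --> \oo] --> 0) :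
  `|x k - T (x k)| @[k --> \oo] --> 0 /\
  x k @[k --> \oo] --> metric_proj (fixpoints T) v.
Proof.
set P := metric_proj _ v.
have TP : fixpoints T P := fixpoints_metric_proj dotE T_nonexp v FixT_neq0.
have alpha0 k : 0 <= alpha k <= 1 by case/andP: (alpha01 k) => /ltW -> /ltW.
have alpha_div :=
  nneseries_pinfty_cvg (fun k => proj1 (andP (alpha0 k))) alpha_sum.
pose M := `|x 0%N - P| + `|v - P|.
have xM k : `|x k - P| <= M by exact: halpern_bounded.
have vTM k : `|v - T (x k)| <= M *+ 2.
  rewrite -(subrKA P v) mulr2n; apply: le_trans (ler_normD _ _) _.
  rewrite lerD//; first by rewrite /M lerDr.
  by rewrite {1}TP; apply: le_trans (T_nonexp _ _) _; rewrite distrC.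
have xreg := halpern_asymptotic_regular T_nonexp alpha01 x_rec vTM
  alpha_cvg0 alpha_div alpha_var.
split => //.
have limsup := dot_limsup_le0 dotE T_nonexp TP xM xreg.
have sq0 : `|x k - P| ^+ 2 @[k --> \oo] --> 0.
  apply: (recursion_cvg0 (b := fun k => dot (v - P) (x k.+1 - P) *+ 2)
     (c := fun=> 0) alpha0 alpha_div) => //.
  - move=> e e0; have e2 : 0 < e / 2 by lra.
    have [N _ NP] := limsup _ e2; exists N => // k /= Nk.
    by have /= := NP k.+1 (leqW Nk); lra.
  - rewrite (_ : series _ = fun=> 0); first exact: is_cvg_cst.
    by apply/funext => n; rewrite /series /= big1.
  - by move=> k; rewrite addr0; exact: halpern_step.
apply/cvgrPdist_le => e e0; have e2 : 0 < e ^+ 2 by rewrite exprn_gt0.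
move/cvgrPdist_le: sq0 => /(_ _ e2); apply: filterS => k.
rewrite sub0r normrN ger0_norm ?sqr_ge0// distrC.
by rewrite ler_pXn2r ?nnegrE ?(ltW e0).
Qed.
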